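(* The query language coGMSNP has the same expressive power as frontier-guarded DDlog and is strictly more expressive than coMMSNP.
   Context: **Queries.** A schema $\mathbf{S}$ is a finite set of relation symbols with arities. An instance $\mathfrak{D}$ over $\mathbf{S}$ is a finite set of facts $R(a_1,\dots,a_n)$, $R\in\mathbf{S}$, with $a_i$ from a fixed countably infinite set of constants; $\mathrm{adom}(\mathfrak{D})$ is the set of constants occurring in $\mathfrak{D}$. An $n$-ary query over $\mathbf{S}$ maps each $\mathbf{S}$-instance $\mathfrak{D}$ to a set $q(\mathfrak{D})\subseteq \mathrm{adom}(\mathfrak{D})^n$. Two queries over $\mathbf{S}$ are equivalent if they agree on all $\mathbf{S}$-instances. A query language is a set of queries. $\mathcal{Q}_2$ is at least as expressive as $\mathcal{Q}_1$ if every query of $\mathcal{Q}_1$ over some schema $\mathbf{S}$ is equivalent to a query of $\mathcal{Q}_2$ over $\mathbf{S}$; they have the same expressive power if this holds in both directions; $\mathcal{Q}_2$ is strictly more expressive than $\mathcal{Q}_1$ if it holds in this direction but not conversely. **coMMSNP and coGMSNP.** A GMSNP formula over $\mathbf{S}$ has the form $\exists X_1\cdots\exists X_n\forall x_1\cdots\forall x_m\,\varphi$ with $X_1,\dots,X_n$ second-order variables of any arity, $x_1,\dots,x_m$ first-order variables, and $\varphi$ a conjunction of formulas $\alpha_1\wedge\cdots\wedge\alpha_k\to\beta_1\vee\cdots\vee\beta_l$ with $k,l\ge 0$, where each $\alpha_i$ is of the form $X_j(\mathbf{x})$, $R(\mathbf{x})$ with $R\in\mathbf{S}$, or $x=y$,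 and each $\beta_i$ is of the form $X_j(\mathbf{x})$; additionally, for every head atom $\beta_i$ there must be a body atom $\alpha_j$ containing all variables of $\beta_i$. An MMSNP formula is defined in the same way except that all second-order variables are monadic and the additional requirement on head atoms is dropped. In both cases free first-order variables are admitted; a formula without them is a sentence. A formula $\Phi$ over $\mathbf{S}$ with $n$ free variables gives rise to the query $q_{\Phi,\mathbf{S}}(\mathfrak{D})=\{\mathbf{a}\in\mathrm{adom}(\mathfrak{D})^n\mid(\mathrm{adom}(\mathfrak{D}),\mathfrak{D})\not\models\Phi[\mathbf{a}]\}$, where $(\mathrm{adom}(\mathfrak{D}),\mathfrak{D})\models\Phi$ is set to true when $\mathfrak{D}$ is empty and $\Phi$ is a sentence. coGMSNP (coMMSNP) is the language of all queries arising in this way from GMSNP (MMSNP) formulas. **Frontier-guarded DDlog.** A disjunctive datalog rule has the form $S_1(\mathbf{x}_1)\vee\cdots\vee S_m(\mathbf{x}_m)\leftarrow R_1(\mathbf{y}_1)\wedge\cdots\wedge R_n(\mathbf{y}_n)$, $m\ge 0$, $n>0$, where every head variable occurs in the body (empty head: $\bot$). A disjunctive datalog (DDlog) program $\Pi$ is a finite set of such rules with a selected predicate $\mathsf{goal}$ that does not occur in rule bodies and occurs in heads only in goal rules $\mathsf{goal}(\mathbf{x})\leftarrow R_1(\mathbf{x}_1)\wedge\cdots\wedge R_n(\mathbf{x}_n)$. Relation symbols occurring in some rule head are IDB predicates, the others EDB predicates. $\Pi$ defines the query $q_\Pi$ over the schema of its EDB predicates: $q_\Pi(\mathfrak{D})$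 is the set of $\mathbf{a}\in\mathrm{adom}(\mathfrak{D})^n$ ($n$ the arity of $\mathsf{goal}$) with $\mathsf{goal}(\mathbf{a})\in\mathfrak{D}'$ for all instances $\mathfrak{D}'\supseteq\mathfrak{D}$ over the IDB and EDB predicates satisfying all rules of $\Pi$. A rule is frontier-guarded if for each atom $\alpha$ in its head there is an atom $\beta$ in its body such that all variables that occur in $\alpha$ occur also in $\beta$. Frontier-guarded DDlog is the language of queries defined by DDlog programs in which every rule is frontier-guarded.
   Formalization: Goal rules are exempt from frontier-guardedness, since otherwise the claim fails for arity ≥ 2 (A(y1) ∧ B(y2) → ⊥ is GMSNP but has no fully guarded program); schema symbols are required to have arity at least 1. *)

(* Defs.v *)
From mathcomp Require Import all_boot finmap.

Set Implicit Arguments.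
Unset Strict Implicit.
Unset Printing Implicit Defensive.

Local Open Scope fset_scope.

Notation const := nat (only parsing).
Notation var := nat (only parsing).

(* A relation symbol is a pair of a name and an arity, so that symbols with
   the same name and different arities are different symbols. *)
Notation relsym := (nat * nat)%type (only parsing).
Definition arity (R : relsym) : nat := R.2.

Notation atom T := {R : relsym & (arity R).-tuple T}.
Notation fact := (atom const).

Definition sym (T : Type) (A : atom T) : relsym := tag A.
Definition args (T : Type) (A : atom T) : seq T := tagged A.
Definition mk_atom (T : Type) (R : relsym) (t : (arity R).-tuple T) : atom T :=
  existT (fun R : relsym => (arity R).-tuple T) R t.
Arguments mk_atom {T} R t.
Definition map_atom (T U : Type) (h : T -> U) (A : atom T) : atom U :=
  mk_atom (tag A) (map_tuple h (tagged A)).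

(** * Schemas, instances, queries *)

(* Symbols of a schema have positive arity.  This makes an instance empty
   exactly when its active domain is, which the semantics of formulas below
   relies on.  Predicates defined by programs and second-order variables may
   have arity 0. *)
Record schema := Schema {
  symbols : {fset relsym};
  symbols_pos : forall R, R \in symbols -> 0 < arity R }.

Record instance (S : schema) := Instance {
  facts : {fset fact};
  facts_over : forall f, f \in facts -> sym f \in symbols S }.

Definition adom (S : schema) (D : instance S) : {fset const} :=
  [fset c in flatten [seq args f | f <- facts D]].

Record query (S : schema) (n : nat) := Query {
  answer : instance S -> n.-tuple const -> Prop;
  answer_adom : forall D a, answer D a -> {subset a <= adom D} }.

Definition query_equiv (S : schema) (n : nat) (q1 q2 : query S n) : Prop :=
  forall D a, answer q1 D a <-> answer q2 D a.

Definition query_language := forall (S : schema) (n : nat), query S n -> Prop.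

Definition at_least_as_expressive (Q2 Q1 : query_language) : Prop :=
  forall (S : schema) (n : nat) (q1 : query S n), Q1 S n q1 ->
    exists2 q2 : query S n, Q2 S n q2 & query_equiv q1 q2.

Definition same_expressive_power (Q1 Q2 : query_language) : Prop :=
  at_least_as_expressive Q1 Q2 /\ at_least_as_expressive Q2 Q1.

Definition strictly_more_expressive (Q2 Q1 : query_language) : Prop :=
  at_least_as_expressive Q2 Q1 /\ ~ at_least_as_expressive Q1 Q2.

(** * GMSNP and MMSNP *)

Section Clauses.
Variables (S : schema) (k : nat) (soar : 'I_k -> nat) (V : eqType).

Record so_atom := SoAtom { so_var : 'I_k; so_args : (soar so_var).-tuple V }.

Inductive body_atom :=
| BSo of so_atom
| BRel (R : symbols S) of (arity (val R)).-tuple V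
| BEq of V & V.

Definition body_vars (b : body_atom) : seq V :=
  match b with
  | BSo A => so_args A
  | BRel _ t => t
  | BEq x y => [:: x; y]
  end.

Record clause := Clause { cl_body : seq body_atom; cl_head : seq so_atom }.

Definition guarded_clause (c : clause) : bool :=
  all (fun beta => has (fun alpha =>
    all (fun x => x \in body_vars alpha) (so_args beta)) (cl_body c))
  (cl_head c).

(* Truth in the structure (adom D, D) under an interpretation I of the
   second-order variables and an assignment nu of the first-order ones. *)
Variables (D : instance S) (I : forall j : 'I_k, {set (soar j).-tuple (adom D)})
  (nu : V -> adom D).

Definition so_holds (A : so_atom) : bool :=
  map_tuple nu (so_args A) \in I (so_var A).

Definition body_holds (b : body_atom) : bool :=
  match b with
  | BSo A => so_holds A
  | BRel R t => mk_atom (val R) (map_tuple (fun x => val (nu x)) t) \in facts D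
  | BEq x y => nu x == nu y
  end.

Definition clause_holds (c : clause) : bool :=
  all body_holds (cl_body c) ==> has so_holds (cl_head c).

End Clauses.

(* First-order variables of a formula with n free and m universally quantified
   variables. *)
Notation fovar n m := ('I_n + 'I_m)%type (only parsing).

Record formula (S : schema) (n : nat) := Formula {
  num_so : nat;
  so_arity : 'I_num_so -> nat;
  num_fo : nat;
  clauses : seq (clause S so_arity (fovar n num_fo)) }.

Definition is_GMSNP (S : schema) (n : nat) (Phi : formula S n) : Prop :=
  all (@guarded_clause _ _ _ _) (clauses Phi).

Definition is_MMSNP (S : schema) (n : nat) (Phi : formula S n) : Prop :=
  forall j : 'I_(num_so Phi), so_arity j = 1.

Definition assignment (S : schema) (n m : nat) (D : instance S)
    (a : n.-tuple (adom D)) (b : 'I_m -> adom D) (x : fovar n m) : adom D :=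
  match x with inl i => tnth a i | inr j => b j end.

Definition satisfies (S : schema) (n : nat) (Phi : formula S n)
    (D : instance S) (a : n.-tuple (adom D)) : Prop :=
  (facts D = fset0 /\ n = 0) \/
  exists I : forall j, {set (@so_arity _ _ Phi j).-tuple (adom D)},
  forall b : 'I_(num_fo Phi) -> adom D,
    all (clause_holds I (assignment a b)) (clauses Phi).

Definition formula_answer (S : schema) (n : nat) (Phi : formula S n)
    (D : instance S) (a : n.-tuple const) : Prop :=
  exists2 a' : n.-tuple (adom D), a = map_tuple val a' & ~ satisfies Phi a'.

Lemma formula_answer_adom (S : schema) (n : nat) (Phi : formula S n)
    (D : instance S) (a : n.-tuple const) :
  formula_answer Phi D a -> {subset a <= adom D}.
Proof. by case=> a' -> _ c /mapP[x _ ->]; exact: valP. Qed.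

Definition formula_query (S : schema) (n : nat) (Phi : formula S n) : query S n :=
  Query (@formula_answer_adom S n Phi).

Definition coGMSNP : query_language := fun S n q =>
  exists2 Phi : formula S n, is_GMSNP Phi & q = formula_query Phi.

Definition coMMSNP : query_language := fun S n q =>
  exists2 Phi : formula S n, is_MMSNP Phi & q = formula_query Phi.

(** * Disjunctive datalog *)

(* A rule is the pair of its head (a disjunction) and its body (a conjunction). *)
Notation rule := (seq (atom var) * seq (atom var))%type (only parsing).
Definition r_head (r : rule) : seq (atom var) := r.1.
Definition r_body (r : rule) : seq (atom var) := r.2.

Definition head_syms (r : rule) : seq relsym := map (@sym var) (r_head r).
Definition body_syms (r : rule) : seq relsym := map (@sym var) (r_body r).

Definition wf_rule (r : rule) : bool :=
  (r_body r != [::]) &&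
  all (fun A => all (fun x => has (fun B => x \in args B) (r_body r)) (args A))
      (r_head r).

Record program (n : nat) := Program { rules : seq rule; goal_name : nat }.

Section Programs.
Variables (n : nat) (P : program n).

Definition goal : relsym := (goal_name P, n).

Definition is_goal_rule (r : rule) : bool := goal \in head_syms r.

Definition wf_program : bool :=
  all (fun r => [&& wf_rule r, goal \notin body_syms r
                  & is_goal_rule r ==> (size (r_head r) == 1)]) (rules P).

Definition idb : {fset relsym} :=
  [fset R in flatten (map head_syms (rules P))].
Definition edb : {fset relsym} :=
  [fset R in flatten (map body_syms (rules P))] `\` idb.

Definition rule_holds (F : {fset fact}) (r : rule) : Prop :=
  forall h : var -> const,
    all (fun A => map_atom h A \in F) (r_body r) ->
    has (fun A => map_atom h A \in F) (r_head r).

(* The constants of a model need not belong to the active domain of the input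
   instance. *)
Definition is_model (F : {fset fact}) : Prop :=
  (forall f, f \in F -> sym f \in idb `|` edb) /\
  (forall r, r \in rules P -> rule_holds F r).

Definition program_answer (S : schema) (D : instance S) (a : n.-tuple const) : Prop :=
  {subset a <= adom D} /\
  forall F : {fset fact}, facts D `<=` F -> is_model F -> mk_atom goal a \in F.

Lemma program_answer_adom (S : schema) (D : instance S) (a : n.-tuple const) :
  program_answer D a -> {subset a <= adom D}.
Proof. by case. Qed.

Definition program_query (S : schema) : query S n :=
  Query (@program_answer_adom S).

Definition frontier_guarded_rule (r : rule) : bool :=
  all (fun A => has (fun B => all (fun x => x \in args B) (args A)) (r_body r))
      (r_head r).

(* Goal rules are exempt.  For a goal predicate of arity at most 1 this makes no
   difference (frontier_guarded_le1 below).  For larger arities, guarding goal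
   rules as well would exclude queries such as goal(x,y) <- A(x), B(y), which
   combine constants that do not occur together in a fact of the instance and
   which are expressible in coGMSNP. *)
Definition frontier_guarded : bool :=
  all (fun r => is_goal_rule r || frontier_guarded_rule r) (rules P).

Lemma frontier_guarded_le1 :
  n <= 1 -> wf_program -> frontier_guarded = all frontier_guarded_rule (rules P).
Proof.
move=> n1 /allP wf; apply: eq_in_all => r rP.
case gr: (is_goal_rule r) => //=; apply/esym.
have /and3P[/andP[bn wfh] _] := wf r rP; rewrite gr /= => /eqP sz.
move: gr wfh sz; rewrite /frontier_guarded_rule /is_goal_rule /head_syms.
case: (r_head r) => [|A [|]] //=; rewrite inE !andbT => /eqP e wfA _.
have szA : size (args A) <= 1 by rewrite size_tuple -/(sym A) -e.
case: (args A) szA wfA => [|x [|]] //= _; last first.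
  by rewrite andbT; congr is_true; apply: eq_has => B; rewrite andbT.
by move=> _; case: (r_body r) bn.
Qed.

End Programs.

Definition fgDDlog : query_language := fun S n q =>
  exists P : program n, [/\ wf_program P, frontier_guarded P,
    edb P = symbols S & q = program_query P S].

(* Main.v *)
(* A program derives its consequences for all answer tuples at once, whereas a
   formula is evaluated for one tuple a.  To simulate a formula, a program
   guesses for each i and each constant whether the constant is the i-th
   component of a, and derives goal(c) as soon as some c_i is guessed not to be:
   then goal(a) fails in some model iff it fails in one where each a_i is marked,
   and there the clauses can be stated for the marked constants.  Conversely,
   IDB predicates become second-order variables, and a goal rule becomes a clause
   with empty head that equates the goal arguments with the free variables.

   The separating query asks for a path x_0, ..., x_l with S(x_0, y),
   R(x_j, x_(j+1), y) and T(x_l, y).  It fails in the instance with facts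
   S(x, x), R(x, x, y) and T(y, x) for y <> x.  Given monadic predicates there,
   choose x <> y with the same colour, and give this colour to all elements of a
   path that is longer than the number of variables of the formula.  Any choice
   of values for the variables misses an element x_i of the path, so that
   x_j |-> x for j < i and x_j |-> y for j > i is a homomorphism on the values
   taken; hence the MMSNP formula also holds in the instance that is a path. *)
Require Import Defs.
From mathcomp Require Import all_boot finmap.

Set Implicit Arguments.
Unset Strict Implicit.
Unset Printing Implicit Defensive.

Local Open Scope fset_scope.

(** * Atoms and finite models *)

Lemma atom_eq (T : Type) (A B : atom T) :
  sym A = sym B -> args A = args B -> A = B.
Proof.
case: A B => [R t] [R' t'] e; rewrite /sym /= in e; subst R'.
by rewrite /args /= => /val_inj ->.
Qed.

Definition named_atom (T : Type) (N : nat) (s : seq T) : atom T :=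
  mk_atom (N, size s) (in_tuple s).

Lemma sym_named_atom (T : Type) N (s : seq T) : sym (named_atom N s) = (N, size s).
Proof. by []. Qed.

Lemma map_named_atom (T U : Type) (h : T -> U) N (s : seq T) :
  map_atom h (named_atom N s) = named_atom N (map h s).
Proof. by apply: atom_eq; rewrite // !sym_named_atom size_map. Qed.

Lemma sym_map_atom (T U : Type) (h : T -> U) A : sym (map_atom h A) = sym A.
Proof. by []. Qed.

Lemma args_map_atom (T U : Type) (h : T -> U) A :
  args (map_atom h A) = map h (args A).
Proof. by []. Qed.

(** A boolean predicate cuts a set of facts out of a finite universe, given by finitely many symbols
    and constants. Except for the empty set, the models and instances built below all have this
    form. *)
Definition facts_of (Rs : {fset nat * nat}) (C : {fset nat})
    (p : pred (atom nat)) : {fset atom nat} :=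
  [fset f in [seq mk_atom R (map_tuple val t) |
                R <- Rs, t <- enum {: (arity R).-tuple C}] | p f].

Lemma in_facts_of Rs C p f :
  (f \in facts_of Rs C p) = [&& sym f \in Rs, all (mem C) (args f) & p f].
Proof.
rewrite !inE andbA; congr (_ && _); apply/allpairsPdep/andP.
  move=> [R [t [RRs _ ->]]]; split=> //.
  by apply/allP=> c /mapP[x _ ->]; apply: valP.
move=> [fRs /allP fC]; exists (sym f).
(* All arguments lie in [C], so [pmap insub] drops none of them and the length is the arity. *)
have sz : size (pmap (insub : nat -> option C) (args f)) == arity (sym f).
  rewrite size_pmap_sub -(size_tuple (tagged f)); apply/eqP/esym/eqP.
  by rewrite eq_sym -all_count; apply/allP.
exists (Tuple sz); split=> //; first by rewrite mem_enum.
apply: atom_eq => //; rewrite /args /=.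
rewrite -[RHS]/(map val (pmap insub (args f))).
rewrite (pmap_filter (insubK _)); apply/esym/all_filterP/allP=> c cf.
by have /= := fC c cf; case: insubP => //= /negPf ->.
Qed.

(** Well-formed rules have non-empty bodies, so none fires on the empty set. *)
Lemma fset0_model n (P : program n) : wf_program P -> is_model P fset0.
Proof.
move=> /allP wf; split=> [f|r /wf /and3P[/andP[+ _] _ _] h]; first by rewrite inE.
by case: (r_body r) => //= A l _; rewrite inE.
Qed.

Lemma head_in_idb n (P : program n) r A :
  r \in rules P -> A \in r_head r -> sym A \in idb P.
Proof.
move=> rP Ar; rewrite !inE; apply/flattenP; exists (head_syms r).
  exact: map_f.
exact: map_f.
Qed.

Lemma body_in_idb_edb n (P : program n) r A :
  r \in rules P -> A \in r_body r -> sym A \in idb P `|` edb P.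
Proof.
move=> rP Ar; rewrite in_fsetU in_fsetD; case: (sym A \in idb P) => //=.
rewrite inE; apply/flattenP; exists (body_syms r); exact: map_f.
Qed.

Lemma idb_inv n (P : program n) R : R \in idb P ->
  exists r A, [/\ r \in rules P, A \in r_head r & R = sym A].
Proof.
by rewrite inE => /flattenP[_ /mapP[r rP ->] /mapP[A Ar ->]]; exists r, A.
Qed.

Lemma edb_inv n (P : program n) R : R \in edb P ->
  R \notin idb P /\ exists r A, [/\ r \in rules P, A \in r_body r & R = sym A].
Proof.
rewrite in_fsetD => /andP[nR]; rewrite inE => /flattenP[_ /mapP[r rP ->] /mapP[A Ar eR]].
by split=> //; exists r, A.
Qed.

(** Only [p] has to be checked on the rules: head symbols are IDB predicates, and head variables
    occur in the body, so no constant outside [C] arises. *)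
Lemma facts_of_model n (P : program n) C (p : pred (atom nat)) :
  wf_program P ->
  (forall r h, r \in rules P ->
     (forall A, A \in r_body r ->
        all (mem C) (map h (args A)) && p (map_atom h A)) ->
     has (fun A => p (map_atom h A)) (r_head r)) ->
  is_model P (facts_of (idb P `|` edb P) C p).
Proof.
move=> /allP wf hr; split=> [f|r rP h /allP hb].
  by rewrite in_facts_of => /and3P[].
have {}hb A : A \in r_body r -> all (mem C) (map h (args A)) && p (map_atom h A).
  by move=> /hb; rewrite in_facts_of => /andP[_].
have /hasP[A Ar pA] := hr r h rP hb; apply/hasP; exists A => //.
rewrite in_facts_of pA sym_map_atom in_fsetU (head_in_idb rP Ar) /= andbT.
have /and3P[/andP[_ /allP/(_ A Ar)/allP wfA] _ _] := wf r rP.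
apply/allP=> _ /mapP[x xA ->]; have /hasP[B Br xB] := wfA x xA.
by have /andP[/allP hC _] := hb B Br; apply/hC/map_f.
Qed.

Lemma in_adom S (D : instance S) f c :
  f \in facts D -> c \in args f -> c \in adom D.
Proof.
move=> fD cf; rewrite inE; apply/flattenP; exists (args f) => //.
by apply/mapP; exists f.
Qed.

Lemma in_adomP S (D : instance S) c :
  reflect (exists2 f, f \in facts D & c \in args f) (c \in adom D).
Proof.
apply: (iffP idP) => [|[f]]; last exact: in_adom.
by rewrite inE => /flattenP[_ /mapP[f fD ->] cf]; exists f.
Qed.

(** Positive arities enter here: every fact has an argument, and this argument is in the active
    domain. *)
Lemma facts_eq0 S (D : instance S) : (adom D -> False) -> facts D = fset0.
Proof.
move=> noelt; apply/eqP/fset0Pn=> -[f fD].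
have := symbols_pos (facts_over fD); rewrite -(size_tuple (tagged f)).
rewrite -[tval _]/(args f); case E: (args f) => [|c s] // _.
by apply: noelt; exists c; apply: (in_adom fD); rewrite E mem_head.
Qed.

Lemma adom0 S (D : instance S) : facts D = fset0 -> adom D -> False.
Proof. by move=> D0 [c /in_adomP[f]]; rewrite D0 inE. Qed.

Lemma adom_tuple S (D : instance S) n (a : n.-tuple nat) :
  {subset a <= adom D} -> exists a' : n.-tuple (adom D), a = map_tuple val a'.
Proof.
move=> aD; have aD' i : tnth a i \in adom D by apply/aD/mem_tnth.
exists [tuple [` aD' i] | i < n].
by apply: eq_from_tnth => i; rewrite !tnth_map tnth_ord_tuple.
Qed.

(** * From MMSNP to GMSNP *)

(** Adding $x = x$ to each body for every variable changes no truth value, and it guards all heads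
    because a monadic head atom has a single variable. *)
Lemma coGMSNP_coMMSNP : at_least_as_expressive coGMSNP coMMSNP.
Proof.
move=> S n _ [Phi mPhi ->].
pose trivial_eqs := [seq @BEq S (num_so Phi) (@so_arity _ _ Phi) _ x x |
                         x : 'I_n + 'I_(num_fo Phi)].
pose guard c := Clause (cl_body c ++ trivial_eqs) (cl_head c).
pose Psi := Formula [seq guard c | c <- clauses Phi].
exists (formula_query Psi).
  exists Psi => //; rewrite /is_GMSNP all_map.
  rewrite (eq_all (a2 := predT)) ?all_predT // => c; rewrite /guarded_clause /=.
  rewrite (eq_all (a2 := predT)) ?all_predT // => -[j t] /=.
  rewrite has_cat; apply/orP; right; rewrite has_map.
  have : size t = 1 by rewrite size_tuple mPhi.
  case: (tval t) => [|x [|]] // _.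
  by apply/hasP; exists x; rewrite ?mem_enum //= mem_head.
move=> D a.
suff sat a' : satisfies Psi a' <-> @satisfies _ _ Phi D a'.
  by split=> -[a' -> ns]; exists a' => // /sat.
have eqh I b : all (clause_holds I (assignment a' b)) (clauses Psi) =
  @all (clause S (@so_arity _ _ Phi) _) (clause_holds I (assignment a' b)) (clauses Phi).
  rewrite all_map; apply: eq_all => c; rewrite /= /clause_holds /= all_cat.
  suff -> : all (body_holds I (assignment a' b)) trivial_eqs by rewrite andbT.
  by rewrite all_map; apply/allP => x _ /=.
by split=> -[?|[I h]]; [left|right; exists I => b; rewrite -eqh
                       |left|right; exists I => b; rewrite eqh].
Qed.

(** * From GMSNP formulas to frontier-guarded programs *)

(** [T] has no decidable equality, as for clauses and formula atoms. Membership of [x] in [s] is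
    replaced by the property that every boolean predicate true throughout [s] is true of [x]. *)
Lemma mem_map_inv (T : Type) (U : eqType) (f : T -> U) s y :
  y \in map f s -> exists2 x, y = f x & forall p : pred T, all p s -> p x.
Proof.
elim: s => //= x s IH; rewrite inE => /predU1P[->|/IH[z -> hz]].
  by exists x => // p /andP[].
by exists z => // p /andP[_]; apply: hz.
Qed.

Lemma all_of_map (T : Type) (U : eqType) (f : T -> U) (Q : U -> Prop) (p : pred T) s :
  (forall y, y \in map f s -> Q y) -> (forall x, Q (f x) -> p x) -> all p s.
Proof.
move=> hQ hp; elim: s hQ => //= x s IH hQ; rewrite hp ?IH //.
  by move=> y ys; apply: hQ; rewrite inE ys orbT.
by apply: hQ; rewrite mem_head.
Qed.

Lemma wf_frontier_guarded_rule r :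
  r_body r != [::] -> frontier_guarded_rule r -> wf_rule r.
Proof.
rewrite /wf_rule => -> /allP fg; apply/allP=> A /fg /hasP[B Br /allP AB].
by apply/allP=> x /AB xB; apply/hasP; exists B.
Qed.

Section OfFormula.
Variables (S : schema) (n : nat) (Phi : formula S n).
Notation k := (num_so Phi).
Notation fov := ('I_n + 'I_(num_fo Phi))%type.

(** Names from [base] on do not occur in the schema; codes of tags shifted by [base] therefore name
    fresh auxiliary predicates. *)
Definition base : nat := (\max_(R <- symbols S) R.1).+1.

Lemma lt_base R : R \in symbols S -> R.1 < base.
Proof. by move=> RS; rewrite ltnS; apply: (@leq_bigmax_seq _ _ xpredT (fun R => R.1)). Qed.

(* The mark predicates (i, true) and (i, false) guess whether a constant is the
   value of the i-th free variable. *)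
Notation pred_tag := (option (option (option ('I_k + 'I_n * bool))))%type.
Definition goal_tag : pred_tag := None.
Definition adom_tag : pred_tag := Some None.
Definition eq_tag : pred_tag := Some (Some None).
Definition so_tag j : pred_tag := Some (Some (Some (inl j))).
Definition mark_tag i beta : pred_tag := Some (Some (Some (inr (i, beta)))).

Definition tag_name (t : pred_tag) : nat := base + choice.pickle t.

Definition tag_arity (t : pred_tag) : nat :=
  match t with
  | None => n
  | Some None => 1
  | Some (Some None) => 2
  | Some (Some (Some (inl j))) => so_arity j
  | Some (Some (Some (inr _))) => 1
  end.

Definition tag_sym t : nat * nat := (tag_name t, tag_arity t).

Lemma tag_name_inj : injective tag_name.
Proof. by move=> t u /addnI /(pcan_inj choice.pickleK). Qed.

Lemma tag_sym_inj : injective tag_sym.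
Proof. by move=> t u /(congr1 fst) /tag_name_inj. Qed.

Lemma tag_sym_notin t r : (tag_name t, r) \notin symbols S.
Proof. by apply/negP=> /lt_base; rewrite ltnNge leq_addr. Qed.

Definition tag_atom t (s : seq nat) : atom nat := named_atom (tag_name t) s.

(** Coding through [option] leaves a code for one more variable, [dummy], which keeps the body of a
    clause rule non-empty even if the clause has an empty body and the formula has no first-order
    variables. *)
Definition ev (v : fov) : nat := choice.pickle (Some v).
Definition dummy : nat := choice.pickle (None : option fov).

Definition atom_of_so (A : so_atom (@so_arity _ _ Phi) fov) : atom nat :=
  tag_atom (so_tag (so_var A)) (map ev (so_args A)).

Definition atom_of_body (B : body_atom S (@so_arity _ _ Phi) fov) : atom nat :=
  match B with
  | BSo A => atom_of_so A
  | BRel R t => mk_atom (val R) (map_tuple ev t)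
  | BEq x y => tag_atom eq_tag [:: ev x; ev y]
  end.

Definition goal_rule (i : 'I_n) :=
  ([:: tag_atom goal_tag (iota 0 n)],
   tag_atom (mark_tag i false) [:: val i] ::
   [seq tag_atom adom_tag [:: x] | x <- iota 0 n]).
Definition adom_rule (R : nat * nat) (x : nat) :=
  ([:: tag_atom adom_tag [:: x]], [:: mk_atom R (iota_tuple (arity R) 0)]).
Definition trivial_rule (t : pred_tag) :=
  ([:: tag_atom t (iota 0 (tag_arity t))], [:: tag_atom t (iota 0 (tag_arity t))]).
(** A model may give [eq_tag] more than the diagonal. This only makes the clause rules more
    demanding, and the model built from an interpretation uses true equality. *)
Definition eq_rule :=
  ([:: tag_atom eq_tag [:: 0; 0]], [:: tag_atom adom_tag [:: 0]]).
Definition mark_rule (i : 'I_n) :=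
  ([:: tag_atom (mark_tag i true) [:: 0]; tag_atom (mark_tag i false) [:: 0]],
   [:: tag_atom adom_tag [:: 0]]).
Definition clause_rule (c : clause S (@so_arity _ _ Phi) fov) :=
  (map atom_of_so (cl_head c),
   tag_atom adom_tag [:: dummy] ::
   [seq tag_atom adom_tag [:: ev v] | v : fov] ++
   [seq tag_atom (mark_tag i true) [:: ev (inl i)] | i : 'I_n] ++
   map atom_of_body (cl_body c)).

(* The trivial rules make every auxiliary predicate an IDB predicate, even if
   no clause has it in its head. *)
Definition program_of_formula : program n := Program n
  (trivial_rule adom_tag :: eq_rule ::
   [seq goal_rule i | i : 'I_n] ++
   [seq adom_rule R x | R <- symbols S, x <- iota 0 (arity R)] ++
   [seq trivial_rule (so_tag j) | j : 'I_k] ++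
   [seq mark_rule i | i : 'I_n] ++
   map clause_rule (clauses Phi)) (tag_name goal_tag).
Notation P := program_of_formula.

(** * Symbols and syntactic conditions of the constructed program *)

Variant rule_spec : seq (atom nat) * seq (atom nat) -> Prop :=
| GoalRule i : rule_spec (goal_rule i)
| AdomRule R x of R \in symbols S & x < arity R : rule_spec (adom_rule R x)
| TrivialRule t of t != goal_tag : rule_spec (trivial_rule t)
| EqRule : rule_spec eq_rule
| MarkRule i : rule_spec (mark_rule i)
| ClauseRule c of (forall p : pred _, all p (clauses Phi) -> p c) :
    rule_spec (clause_rule c).

Lemma rulesP r : r \in rules P -> rule_spec r.
Proof.
rewrite !inE !mem_cat => /or4P[/eqP ->|/eqP ->||/or4P[]].
- exact: TrivialRule.
- exact: EqRule.
- by case/mapP=> i _ ->; apply: GoalRule.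
- case/allpairsPdep=> [R [x [RS xR ->]]]; apply: AdomRule => //.
  by move: xR; rewrite mem_iota.
- by case/mapP=> i _ ->; apply: TrivialRule.
- by case/mapP=> i _ ->; apply: MarkRule.
- by case/mem_map_inv=> c -> hc; apply: ClauseRule.
Qed.

Lemma goal_rule_in i : goal_rule i \in rules P.
Proof. by rewrite !inE !mem_cat map_f ?mem_enum ?orbT. Qed.

Lemma adom_rule_in R x : R \in symbols S -> x < arity R -> adom_rule R x \in rules P.
Proof.
move=> RS xR; rewrite !inE !mem_cat; apply/or4P/Or44/orP; left.
by apply/allpairsPdep; exists R, x; rewrite mem_iota.
Qed.

Lemma trivial_adom_rule_in : trivial_rule adom_tag \in rules P.
Proof. exact: mem_head. Qed.

Lemma eq_rule_in : eq_rule \in rules P.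
Proof. by rewrite !inE eqxx !orbT. Qed.

Lemma trivial_so_rule_in j : trivial_rule (so_tag j) \in rules P.
Proof.
by rewrite !inE !mem_cat (map_f (fun j => trivial_rule (so_tag j))) ?mem_enum ?orbT.
Qed.

Lemma mark_rule_in i : mark_rule i \in rules P.
Proof. by rewrite !inE !mem_cat (map_f mark_rule) ?mem_enum ?orbT. Qed.

Lemma clause_rule_in r : r \in map clause_rule (clauses Phi) -> r \in rules P.
Proof. by move=> rc; rewrite !inE !mem_cat rc ?orbT. Qed.

Lemma sym_tag_atom t s : size s = tag_arity t -> sym (tag_atom t s) = tag_sym t.
Proof. by move=> e; rewrite /tag_sym -e. Qed.

Lemma sym_atom_of_so A : sym (atom_of_so A) = tag_sym (so_tag (so_var A)).
Proof. by rewrite sym_tag_atom // size_map size_tuple. Qed.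

Lemma args_atom_of_body B : args (atom_of_body B) = map ev (body_vars B).
Proof. by case: B. Qed.

Lemma body_symP r A : rule_spec r -> A \in r_body r ->
  (exists2 t, t != goal_tag & sym A = tag_sym t) \/ sym A \in symbols S.
Proof.
case=> [i|R x RS xR|t tg||i|c _] /=.
- rewrite inE => /predU1P[->|/mapP[x _ ->]]; left.
    by exists (mark_tag i false).
  by exists adom_tag.
- by rewrite inE => /eqP ->; right.
- by rewrite inE => /eqP ->; left; exists t => //; rewrite sym_tag_atom ?size_iota.
- by rewrite inE => /eqP ->; left; exists adom_tag.
- by rewrite inE => /eqP ->; left; exists adom_tag.
- rewrite inE => /predU1P[->|]; first by left; exists adom_tag.
  rewrite !mem_cat => /or3P[/mapP[v _ ->]|/mapP[i _ ->]|/mem_map_inv[B -> _]].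
  + by left; exists adom_tag.
  + by left; exists (mark_tag i true).
  + case: B => [A'|R t|x y] /=.
      by left; exists (so_tag (so_var A')); last exact: sym_atom_of_so.
      by right; apply: valP.
    by left; exists eq_tag.
Qed.

Lemma head_symP r A : rule_spec r -> A \in r_head r ->
  exists t, sym A = tag_sym t /\ (t == goal_tag -> exists i, r = goal_rule i).
Proof.
case=> [i|R x RS xR|t tg||i|c _] /=.
- rewrite inE => /eqP ->; exists goal_tag; rewrite sym_tag_atom ?size_iota //.
  by split=> // _; exists i.
- by rewrite inE => /eqP ->; exists adom_tag.
- rewrite inE => /eqP ->; exists t; rewrite sym_tag_atom ?size_iota //; split=> //.
  by rewrite (negPf tg).
- by rewrite inE => /eqP ->; exists eq_tag.
- by rewrite !inE => /orP[] /eqP ->; [exists (mark_tag i true) | exists (mark_tag i false)].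
- by case/mem_map_inv=> B -> _; exists (so_tag (so_var B)); rewrite sym_atom_of_so.
Qed.

Lemma tag_sym_idb t : t != goal_tag -> tag_sym t \in idb P.
Proof.
case: t => [[[[j|[i [|]]]|]|]|//] _.
- rewrite -(@sym_tag_atom (so_tag j) (iota 0 (so_arity j))) ?size_iota //.
  by apply: (head_in_idb (trivial_so_rule_in j)); rewrite mem_head.
- by apply: (@head_in_idb _ _ _ (tag_atom _ [:: 0]) (mark_rule_in i)); rewrite mem_head.
- by apply: (@head_in_idb _ _ _ (tag_atom _ [:: 0]) (mark_rule_in i)); rewrite !inE eqxx orbT.
- by apply: (@head_in_idb _ _ _ (tag_atom _ [:: 0; 0]) eq_rule_in); rewrite mem_head.
- by apply: (@head_in_idb _ _ _ (tag_atom _ [:: 0]) trivial_adom_rule_in); rewrite mem_head.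
Qed.

Lemma idb_symP R : R \in idb P -> exists t, R = tag_sym t.
Proof.
case/idb_inv=> r [A [/rulesP rP Ar ->]].
by have [t [-> _]] := head_symP rP Ar; exists t.
Qed.

Lemma schema_notin_idb R : R \in symbols S -> R \notin idb P.
Proof.
move=> RS; apply/negP=> /idb_symP[t eR]; move: RS.
by rewrite eR (negPf (tag_sym_notin _ _)).
Qed.

Lemma edb_program_of_formula : edb P = symbols S.
Proof.
apply/fsetP=> R; apply/idP/idP => [/edb_inv[nidb [r [A [/rulesP rP Ar eR]]]]|RS].
  case: (body_symP rP Ar) => [[t tg eA]|]; last by rewrite eR.
  by case/negP: nidb; rewrite eR eA tag_sym_idb.
have := body_in_idb_edb (adom_rule_in RS (symbols_pos RS)) (mem_head _ _).
by rewrite in_fsetU (negPf (schema_notin_idb RS)).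
Qed.

(** The guard of a head atom is translated to a body atom with the same variables. This includes
    guards that are equalities, since equality is represented by the predicate [eq_tag]. *)
Lemma wf_program_of_formula : is_GMSNP Phi -> wf_program P /\ frontier_guarded P.
Proof.
move=> gPhi.
have goal_sym r A : rule_spec r -> A \in r_head r -> sym A = tag_sym goal_tag ->
    exists i, r = goal_rule i.
  move=> rs Ar eA; have [t [et]] := head_symP rs Ar; apply.
  by move: et; rewrite eA => /tag_sym_inj ->.
have fg r : rule_spec r -> is_goal_rule P r || frontier_guarded_rule r.
  case=> [i|R x RS xR|t tg||i|c hc].
  - apply/orP; left; apply/mapP; exists (tag_atom goal_tag (iota 0 n)); first exact: mem_head.
    by rewrite sym_tag_atom ?size_iota.
  - rewrite /frontier_guarded_rule /= orbF !andbT; apply/orP; right.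
    by rewrite [args _]/= mem_iota.
  - rewrite /frontier_guarded_rule /= orbF andbT; apply/orP; right.
    by apply/allP.
  - by rewrite orbC.
  - by rewrite orbC.
  - apply/orP; right; apply/allP=> _ /mem_map_inv[A -> hA].
    rewrite /= !has_cat has_map; apply/orP; right; apply/orP; right; apply/orP; right.
    apply: sub_has (hA _ (hc _ gPhi)) => B /allP AB.
    rewrite /= args_atom_of_body; apply/allP=> _ /mapP[x /AB xB ->]; exact: map_f.
split; last by apply/allP=> r /rulesP/fg.
apply/allP=> r rP; have rs := rulesP rP; apply/and3P; split.
- have [[i ->]|ngr] : (exists i, r = goal_rule i) \/ ~~ is_goal_rule P r.
    case: (boolP (is_goal_rule P r)) => [/mapP[A Ar eA]|]; last by right.
    by left; apply: goal_sym rs Ar _; rewrite -eA.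
  + rewrite /wf_rule /= andbT; apply/allP=> x xn; apply/orP; right; rewrite has_map.
    by apply/hasP; exists x => //=; rewrite mem_head.
  + have := fg r rs; rewrite (negPf ngr); apply: wf_frontier_guarded_rule.
    by case: rs.
- apply/negP=> /mapP[A Ar eA]; case: (body_symP rs Ar) => [[t tg]|]; rewrite -eA.
    by move=> /(@tag_sym_inj goal_tag) et; rewrite -et eqxx in tg.
  by rewrite (negPf (tag_sym_notin goal_tag n)).
- by apply/implyP=> /mapP[A Ar eA]; have [i ->] := goal_sym r A rs Ar (esym eA).
Qed.

(** * Models of the program and interpretations of the second-order variables *)

Section Models.
Variables (D : instance S) (a : n.-tuple (adom D)).

Lemma assignmentP (b : 'I_(num_fo Phi) -> adom D) (d : nat) :
  exists2 h : nat -> nat, forall v, h (ev v) = val (assignment a b v) & h dummy = d.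
Proof.
exists (fun x => if choice.unpickle x is Some (Some v) then val (assignment a b v) else d).
  by move=> v; rewrite /ev choice.pickleK.
by rewrite /dummy choice.pickleK.
Qed.

Lemma map_tag_atom (h : nat -> nat) t s : map_atom h (tag_atom t s) = tag_atom t (map h s).
Proof. exact: map_named_atom. Qed.

Lemma satisfies_of_program_model (F : {fset atom nat}) :
  facts D `<=` F -> is_model P F -> mk_atom (goal P) (map_tuple val a) \notin F ->
  satisfies Phi a.
Proof.
move=> /fsubsetP DF [_ mF] nga.
(* With an empty active domain the existence of [a] forces $n = 0$, and satisfaction holds by
   convention. Otherwise [d] serves as the value of [dummy]. *)
case: (pickP (predT : pred (adom D))) => [d _|noelt]; last first.
  left; split; first by apply: facts_eq0 => d; have := noelt d.
  by case: n a => // n' a'; have := noelt (tnth a' ord0).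
have adomF c : c \in adom D -> tag_atom adom_tag [:: c] \in F.
  case/in_adomP=> f fD cf; have fS := facts_over fD.
  have lt : index c (args f) < arity (sym f).
    by rewrite -(size_tuple (tagged f)) index_mem.
  have := mF _ (adom_rule_in fS lt) (nth 0 (args f)).
  rewrite /= !andbT orbF map_tag_atom /= nth_index //; apply.
  suff -> : map_atom (nth 0 (args f)) (mk_atom (sym f) (iota_tuple (arity (sym f)) 0)) = f.
    exact: DF.
  apply: atom_eq => //; rewrite args_map_atom -[args (mk_atom _ _)]/(iota 0 (arity (sym f))).
  by rewrite -(size_tuple (tagged f)) map_nth_iota0 // take_size.
have eqF c : c \in adom D -> tag_atom eq_tag [:: c; c] \in F.
  move=> /adomF cF; have := mF _ eq_rule_in (fun _ => c).
  by rewrite /= !andbT orbF !map_tag_atom; apply.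
(* If $a_i$ were marked negatively, the goal rule for $i$ would derive the excluded goal fact. *)
have markF i : tag_atom (mark_tag i true) [:: val (tnth a i)] \in F.
  have := mF _ (mark_rule_in i) (fun _ => val (tnth a i)).
  rewrite /= !andbT orbF !map_tag_atom adomF ?valP // => /(_ isT)/orP[//|mF'].
  have := mF _ (goal_rule_in i) (nth 0 (map val a)).
  rewrite /= orbF !map_tag_atom /= (nth_map (tnth a i)) ?size_tuple //.
  rewrite -tnth_nth mF' /= => goalF.
  case/negP: nga.
  suff <- : tag_atom goal_tag [seq nth 0 (map val a) j | j <- iota 0 n] =
      mk_atom (goal P) (map_tuple val a).
    apply: goalF; rewrite all_map; apply/allP=> x; rewrite mem_iota /= => lt_xn.
    by rewrite map_tag_atom adomF // (nth_map (tnth a i)) ?size_tuple.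
  have e : [seq nth 0 (map val a) j | j <- iota 0 n] = map val a.
    by rewrite map_nth_iota0 ?size_map ?size_tuple // take_oversize // size_map size_tuple.
  apply: atom_eq; last by rewrite [LHS]e.
  by rewrite sym_tag_atom // size_map size_iota.
pose I j : {set (@so_arity _ _ Phi j).-tuple (adom D)} :=
  [set t | tag_atom (so_tag j) (map val (tval t)) \in F].
right; exists I => b.
have [h hv hd] := assignmentP b (val d).
have soE A : (map_atom h (atom_of_so A) \in F) = so_holds I (assignment a b) A.
  rewrite /so_holds inE map_tag_atom; congr (tag_atom _ _ \in F).
  by rewrite -!map_comp; apply: eq_map.
apply: (all_of_map (fun r rc => mF r (clause_rule_in rc))) => c /(_ h).
rewrite /clause_holds [in has _ _]/= has_map => hc; apply/implyP=> hb.
rewrite -(eq_has soE); apply: hc.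
rewrite /= !map_tag_atom /= hd (adomF _ (fsvalP d)) /= !all_cat !all_map; apply/and3P; split.
- by apply/allP=> v _; rewrite /= map_tag_atom /= hv (adomF _ (fsvalP _)).
- by apply/allP=> i _; rewrite /= map_tag_atom /= hv markF.
apply: sub_all hb => -[A|R t|x y] /=; first by rewrite -soE.
  move=> /DF; set f := mk_atom _ _; set g := map_atom _ _; suff -> : f = g by [].
  by apply: atom_eq => //; rewrite /f /g args_map_atom /args /= -map_comp; apply/esym/eq_map.
by move=> /eqP e; rewrite map_tag_atom /= !hv e (eqF _ (fsvalP _)).
Qed.

(** The intended meaning of the auxiliary predicates: the goal holds of every tuple except [a], and
    $a_i$ is the only constant with the positive $i$-th mark. *)
Definition tag_ext (I : forall j, {set (@so_arity _ _ Phi j).-tuple (adom D)})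
    (t : pred_tag) (s : seq nat) : bool :=
  match t with
  | None => s != map val a
  | Some None => true
  | Some (Some None) => nth 0 s 0 == nth 0 s 1
  | Some (Some (Some (inl j))) => [exists u in I j, map val (tval u) == s]
  | Some (Some (Some (inr (i, beta)))) => (s == [:: val (tnth a i)]) == beta
  end.

(** A symbol outside the schema with a name below [base] may be decoded wrongly by the truncated
    subtraction. This is harmless, as [facts_of] keeps only symbols of the program. *)
Definition ext I (f : atom nat) : bool :=
  if sym f \in symbols S then f \in facts D
  else if choice.unpickle ((sym f).1 - base) is Some t then tag_ext I t (args f)
  else false.

Lemma ext_tag_atom I t s : ext I (tag_atom t s) = tag_ext I t s.
Proof. by rewrite /ext (negPf (tag_sym_notin t _)) addKn choice.pickleK. Qed.

Lemma ext_atom_of_so I A h nu : (forall v, h (ev v) = val (nu v)) ->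
  ext I (map_atom h (atom_of_so A)) = so_holds I nu A.
Proof.
move=> hv; rewrite map_tag_atom ext_tag_atom /so_holds /=.
have e : map h (map ev (so_args A)) = map val (map_tuple nu (so_args A)).
  by rewrite -!map_comp; apply: eq_map.
rewrite e; apply/existsP/idP => [[u /andP[uI /eqP eu]]|tI].
  suff <- : u = map_tuple nu (so_args A) by [].
  by apply: val_inj; apply: (inj_map val_inj).
by exists (map_tuple nu (so_args A)); rewrite tI /=.
Qed.

Lemma program_model_of_satisfies : is_GMSNP Phi -> satisfies Phi a ->
  exists F, [/\ facts D `<=` F, is_model P F
              & mk_atom (goal P) (map_tuple val a) \notin F].
Proof.
move=> /wf_program_of_formula[wfP _].
case=> [[D0 _]|[I hI]].
  by exists fset0; rewrite D0 fsubset_refl inE; split=> //; apply: fset0_model.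
exists (facts_of (idb P `|` edb P) (adom D) (ext I)); split.
- apply/fsubsetP=> f fD; have fS := facts_over fD.
  rewrite in_facts_of in_fsetU edb_program_of_formula fS orbT /ext fS fD andbT.
  by apply/allP=> c; apply: in_adom.
- apply: facts_of_model => // r h /rulesP[i|R x RS xR|t tg||i|c hc] hb /=.
  (* If the goal tuple were [a], its $i$-th component would be $a_i$, which has no negative mark. *)
  + have /andP[_] := hb _ (mem_head _ _); rewrite !map_tag_atom !ext_tag_atom /= orbF eqbF_neg.
    apply: contraNneq => eqs; have := congr1 (nth 0 ^~ i) eqs.
    rewrite (nth_map 0) ?size_iota // nth_iota // (nth_map (tnth a i)) ?size_tuple //.
    by rewrite -tnth_nth add0n => ->; rewrite eqxx.
  + by rewrite map_tag_atom ext_tag_atom.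
  + by have /andP[_ ->] := hb _ (mem_head _ _).
  + by rewrite map_tag_atom ext_tag_atom /= eqxx.
  + by rewrite !map_tag_atom !ext_tag_atom /= orbF eqb_id eqbF_neg orbN.
  (* The domain atoms of the body place all formula variables in the active domain, and the positive
     marks force the free ones to take the values [a]. *)
  + have hA v : h (ev v) \in adom D.
      have /andP[/andP[]] : all (mem (adom D)) [:: h (ev v)] &&
          ext I (map_atom h (tag_atom adom_tag [:: ev v])); last by [].
      apply: hb; rewrite inE !mem_cat.
      by rewrite (map_f (fun v => tag_atom adom_tag [:: ev v])) ?mem_enum ?orbT.
    pose nu (v : fov) := [` hA v].
    have nuE v : assignment a (fun j => nu (inr j)) v = nu v.
      case: v => //= i; apply: val_inj.
      have /andP[_] : all (mem (adom D)) [:: h (ev (inl i))] &&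
          ext I (map_atom h (tag_atom (mark_tag i true) [:: ev (inl i)])).
        apply: hb; rewrite inE !mem_cat.
        by rewrite (map_f (fun i => tag_atom (mark_tag i true) [:: ev (inl i)]))
          ?mem_enum ?orbT.
      by rewrite map_tag_atom ext_tag_atom /= eqb_id => /eqP[<-].
    have hv v : h (ev v) = val (assignment a (fun j => nu (inr j)) v) by rewrite nuE.
    have := hc _ (hI (fun j => nu (inr j))); rewrite /clause_holds => /implyP.
    rewrite has_map (eq_has (fun A => ext_atom_of_so I A hv)); apply.
    have : all (fun A => ext I (map_atom h A)) (map atom_of_body (cl_body c)).
      apply/allP=> A Ac; suff /hb/andP[] : A \in r_body (clause_rule c) by [].
      by rewrite inE !mem_cat Ac !orbT.
    rewrite all_map; apply: sub_all => -[A|R t|x y] /=.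
    * by rewrite (ext_atom_of_so I A hv).
    * rewrite /ext sym_map_atom (valP R : _ \in _).
      set f := map_atom _ _; set g := mk_atom _ _.
      suff -> : f = g by [].
      by apply: atom_eq => //; rewrite /f /g args_map_atom /args /= -map_comp; apply: eq_map.
    * by rewrite map_tag_atom ext_tag_atom /= !hv.
have -> : mk_atom (goal P) (map_tuple val a) = tag_atom goal_tag (map val a).
  by apply: atom_eq; rewrite ?sym_tag_atom ?size_map ?size_tuple.
by rewrite in_facts_of ext_tag_atom /= eqxx !andbF.
Qed.

End Models.
Lemma program_of_formula_equiv : is_GMSNP Phi ->
  query_equiv (formula_query Phi) (program_query P S).
Proof.
move=> gPhi D a; split=> [[a' -> nsat]|[aD goalF]].
  split=> [c /mapP[x _ ->]|F DF mF]; first exact: valP.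
  apply: contraT => ngoal; case: nsat; exact: satisfies_of_program_model DF mF ngoal.
have [a' ea] := adom_tuple aD.
exists a' => // /(program_model_of_satisfies gPhi)[F [DF mF]].
by move/negP; apply; have := goalF F DF mF; rewrite ea.
Qed.

End OfFormula.

Lemma coGMSNP_fgDDlog : at_least_as_expressive fgDDlog coGMSNP.
Proof.
move=> S n _ [Phi gPhi ->]; have [wfP fgP] := wf_program_of_formula gPhi.
exists (program_query (program_of_formula Phi) S); last exact: program_of_formula_equiv.
by exists (program_of_formula Phi); split=> //; apply: edb_program_of_formula.
Qed.

(** * From frontier-guarded programs to GMSNP formulas *)

Lemma mktuple_nth (T U : Type) (x0 : T) (f : T -> U) r (s : seq T) :
  size s = r -> tval [tuple f (nth x0 s i) | i < r] = map f s.
Proof.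
move=> sz; apply: (@eq_from_nth _ (f x0)); rewrite size_tuple ?size_map // => i lt_ir.
by rewrite -(tnth_nth _ _ (Ordinal lt_ir)) tnth_mktuple (nth_map x0) ?sz.
Qed.

Lemma pmap_all_has (T : eqType) (U : Type) (f : T -> option U) p q s :
  (forall x, x \in s -> exists2 y, f x = Some y & q y = p x) ->
  all q (pmap f s) = all p s /\ has q (pmap f s) = has p s.
Proof.
elim: s => //= x s IH hf; have [y -> /= ->] := hf x (mem_head _ _).
have [|-> ->] // := IH _ => z zs; apply: hf; rewrite inE zs orbT //.
Qed.

Section OfProgram.
Variables (S : schema) (n : nat) (P : program n).

Definition idb_sym (j : 'I_(size (idb P))) : nat * nat := nth (0, 0) (idb P) j.

Definition idb_arity j := arity (idb_sym j).

(** A bound on all variables of the program, so that [inord] in [fo_var] identifies no two of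
    them. *)
Definition max_var : nat :=
  \max_(r <- rules P) \max_(A <- r_body r ++ r_head r) \max_(x <- args A) x.

Notation fov := ('I_n + 'I_max_var.+1)%type.
Notation so := (so_atom idb_arity fov).
Notation bo := (body_atom S idb_arity fov).

Definition fo_var (x : nat) : fov := inr (inord x).

Definition so_of_atom (A : atom nat) : option so :=
  omap (fun j => SoAtom [tuple fo_var (nth 0 (args A) i) | i < idb_arity j])
    (insub (index (sym A) (idb P))).

Definition body_of_atom (A : atom nat) : option bo :=
  if so_of_atom A is Some B then Some (BSo S B)
  else omap (fun R : symbols S =>
         @BRel S _ idb_arity fov R [tuple fo_var (nth 0 (args A) i) | i < arity (val R)])
       (insub (sym A)).

Definition goal_eqs (A : atom nat) : seq bo :=
  [seq BEq _ _ (inl i) (fo_var (nth 0 (args A) i)) | i : 'I_n].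

Definition clause_of_rule (r : seq (atom nat) * seq (atom nat)) : clause S idb_arity fov :=
  if is_goal_rule P r then
    Clause (pmap body_of_atom (r_body r) ++ flatten (map goal_eqs (r_head r))) [::]
  else Clause (pmap body_of_atom (r_body r)) (pmap so_of_atom (r_head r)).

Definition formula_of_program : formula S n :=
  Formula [seq clause_of_rule r | r <- rules P].

Lemma so_of_atomP A : sym A \in idb P ->
  exists B, [/\ so_of_atom A = Some B, idb_sym (so_var B) = sym A
              & tval (so_args B) = map fo_var (args A)].
Proof.
move=> Ai; rewrite /so_of_atom.
have lt : index (sym A) (idb P) < size (idb P) by rewrite index_mem.
rewrite insubT /=; eexists; split=> //; first by rewrite /idb_sym /= nth_index.
apply: mktuple_nth; rewrite size_tuple /idb_arity /idb_sym nth_index //.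
Qed.

Lemma body_vars_of_atom A : sym A \in idb P `|` symbols S ->
  exists B, [/\ body_of_atom A = Some B & body_vars B = map fo_var (args A)].
Proof.
rewrite in_fsetU /body_of_atom.
case: (boolP (sym A \in idb P)) => [/so_of_atomP[B [-> _ e]]|nA] /=.
  by exists (BSo S B).
move=> AS; rewrite /so_of_atom insubF ?index_mem ?(negPf nA) //=.
rewrite insubT /=; eexists; split=> //=; apply: mktuple_nth.
by rewrite size_tuple.
Qed.

Lemma le_max_var r A x :
  r \in rules P -> A \in r_body r ++ r_head r -> x \in args A -> x <= max_var.
Proof.
move=> rP Ar xA; rewrite /max_var (big_rem r) //= (big_rem A) //= (big_rem x) //=.
by rewrite -!maxnA leq_maxl.
Qed.

Section Holds.
Variables (D : instance S) (a : n.-tuple (adom D)) (b : 'I_max_var.+1 -> adom D).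
Variables (I : forall j, {set (idb_arity j).-tuple (adom D)}) (p : pred (atom nat)).
Hypothesis pE : forall j (t : (idb_arity j).-tuple (adom D)),
  p (mk_atom (idb_sym j) (map_tuple val t)) = (t \in I j).
Variables (h : nat -> nat) (A : atom nat).
Hypothesis hb : forall x, x \in args A -> val (b (inord x)) = h x.

Lemma so_holds_atom : sym A \in idb P ->
  exists2 B, so_of_atom A = Some B &
    so_holds I (assignment a b) B = p (map_atom h A).
Proof.
move=> /so_of_atomP[B [-> symB argsB]]; exists B => //; rewrite /so_holds -pE.
congr (p _); apply: atom_eq => //; rewrite args_map_atom /args /=.
by rewrite argsB -!map_comp; apply/eq_in_map => x /hb.
Qed.

Lemma body_holds_atom : sym A \in idb P `|` symbols S ->
  exists2 B, body_of_atom A = Some B &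
    body_holds I (assignment a b) B =
    if sym A \in idb P then p (map_atom h A) else map_atom h A \in facts D.
Proof.
rewrite in_fsetU /body_of_atom; case: (boolP (sym A \in idb P)) => [idbA _|nA /= AS].
  by have [B -> e] := so_holds_atom idbA; exists (BSo S B).
rewrite /so_of_atom insubF ?index_mem ?(negPf nA) //= insubT /=.
eexists; first reflexivity.
rewrite /=; set f := mk_atom _ _; suff -> : f = map_atom h A by [].
apply: atom_eq => //.
rewrite args_map_atom /args /= mktuple_nth ?size_tuple //.
by rewrite -!map_comp; apply/eq_in_map => x /hb.
Qed.

End Holds.

(** * Guardedness and correctness of the translated formula *)

Hypotheses (wfP : wf_program P) (fgP : frontier_guarded P) (edbP : edb P = symbols S).

(** Goal rules become clauses with empty head, so their exemption from frontier-guardedness does no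
    harm; the other rules keep their guards. *)
Lemma formula_of_program_GMSNP : is_GMSNP formula_of_program.
Proof.
rewrite /is_GMSNP all_map; apply/allP=> r rP /=; rewrite /guarded_clause /clause_of_rule.
have /orP[->//|fgr] := allP fgP r rP; case: ifP => // _ /=.
(* Formula atoms have no decidable equality, so the argument is an induction on sublists of the head
   and then of the body. *)
elim: {-2}(r_head r) (fun A (Ar : A \in r_head r) => Ar) => //= A l IH sub.
have Ar : A \in r_head r by apply/sub/mem_head.
have [B [-> _ argsB]] := so_of_atomP (head_in_idb rP Ar).
rewrite /= IH ?andbT; last by move=> A' A'l; apply: sub; rewrite inE A'l orbT.
have /hasP[G Gr /allP AG] := allP fgr A Ar.
rewrite argsB; elim: (r_body r) Gr (fun B => @body_in_idb_edb _ P r B rP) => //= G' l' IH'.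
rewrite inE => /predU1P[<- sub'|Gl sub'].
  have := sub' G (mem_head _ _); rewrite edbP => /body_vars_of_atom[G'' [-> e]] /=.
  by rewrite e all_map; apply/orP; left; apply/allP=> x /AG xG; apply: map_f.
have hl : forall B, B \in l' -> sym B \in idb P `|` edb P.
  by move=> C Cl; apply: sub'; rewrite inE Cl orbT.
by case: body_of_atom => [?|] /=; rewrite (IH' Gl hl) ?orbT.
Qed.

(** Both directions use this equation: [p] is either membership in a given model or the predicate
    read off from [I]. For a goal rule the head turns into the failure of the equalities, that is,
    the derived tuple differs from [a]. *)
Lemma clause_of_ruleE (D : instance S) (a : n.-tuple (adom D))
    (b : 'I_max_var.+1 -> adom D) (I : forall j, {set (idb_arity j).-tuple (adom D)})
    (p : pred (atom nat)) (h : nat -> nat) r :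
  (forall j t, p (mk_atom (idb_sym j) (map_tuple val t)) = (t \in I j)) ->
  r \in rules P ->
  (forall A x, A \in r_body r -> x \in args A -> val (b (inord x)) = h x) ->
  clause_holds I (assignment a b) (clause_of_rule r) =
  (all (fun A => if sym A \in idb P then p (map_atom h A)
                 else map_atom h A \in facts D) (r_body r) ==>
   has (fun A => if is_goal_rule P r then map h (args A) != map val a
                 else p (map_atom h A)) (r_head r)).
Proof.
move=> pE rP hbb; have /and3P[/andP[_ wfr] _ /implyP one] := allP wfP r rP.
have hbh A x : A \in r_head r -> x \in args A -> val (b (inord x)) = h x.
  move=> Ar xA; have /hasP[B Br xB] := allP (allP wfr A Ar) x xA; exact: hbb Br xB.
have [eb _] := @pmap_all_has _ _ body_of_atom
    (fun A => if sym A \in idb P then p (map_atom h A) else map_atom h A \in facts D)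
    (body_holds I (assignment a b)) (r_body r)
    (fun A Ar => @body_holds_atom D a b I p pE h A (hbb A ^~ Ar)
       (eq_ind _ (fun X => sym A \in _ `|` X) (body_in_idb_edb rP Ar) _ edbP)).
rewrite /clause_holds /clause_of_rule.
case: (boolP (is_goal_rule P r)) => [gr|_] /=; last first.
  rewrite eb; congr (_ ==> _).
  by have [_ ->] := pmap_all_has
    (fun A Ar => so_holds_atom a pE (hbh A ^~ Ar) (head_in_idb rP Ar)).
rewrite all_cat eb implybF negb_and implybE; congr (_ || _).
move: gr (one gr) hbh; rewrite /is_goal_rule /head_syms.
case: (r_head r) => [|A []] //=; rewrite inE => /eqP gA _ hbh.
rewrite cats0 orbF all_map; congr negb.
have szA : size (args A) = n by rewrite size_tuple -/(sym A) -gA.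
have hb x : x \in args A -> val (b (inord x)) = h x by apply: hbh; rewrite mem_head.
apply/allP/eqP => [eqs|eqA i _ /=].
  apply: (@eq_from_nth _ 0); first by rewrite !size_map szA size_tuple.
  move=> i; rewrite size_map szA => lt_in.
  have /= /eqP/(congr1 val) := eqs (Ordinal lt_in) (mem_enum _ _).
  rewrite hb ?mem_nth ?szA // (nth_map 0) ?szA // => <-.
  by rewrite (nth_map (tnth a (Ordinal lt_in))) ?size_tuple // -(tnth_nth _ a (Ordinal lt_in)).
apply/eqP/val_inj; rewrite hb ?mem_nth ?szA //.
have := congr1 (nth 0 ^~ i) eqA; rewrite (nth_map 0) ?szA // => ->.
by rewrite (nth_map (tnth a i)) ?size_tuple // -tnth_nth.
Qed.

(** The IDB relations of [F] are restricted to tuples over the active domain. [F] may have further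
    constants, but the rules are universal and so survive the restriction. *)
Lemma satisfies_of_model (D : instance S) (a : n.-tuple (adom D)) F :
  facts D `<=` F -> is_model P F -> mk_atom (goal P) (map_tuple val a) \notin F ->
  satisfies formula_of_program a.
Proof.
move=> /fsubsetP DF [_ mF] nga; right.
exists (fun j => [set t | mk_atom (idb_sym j) (map_tuple val t) \in F]) => b.
rewrite all_map; apply/allP => r rP /=; pose h x := val (b (inord x)).
rewrite (@clause_of_ruleE D a b _ (fun f => f \in F) h) //; last by move=> j t; rewrite inE.
apply/implyP=> /allP hb; have /(_ _)/hasP[|A Ar AF] := mF r rP h.
  by apply/allP=> A /hb; case: ifP => // _ /DF.
apply/hasP; exists A => //; case: ifP => // gr.
apply: contra nga => /eqP eqA.
suff <- : map_atom h A = mk_atom (goal P) (map_tuple val a) by [].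
apply: atom_eq => //; rewrite sym_map_atom.
have /and3P[_ _ /implyP/(_ gr)] := allP wfP r rP; move: gr Ar.
rewrite /is_goal_rule /head_syms; case: (r_head r) => [|A' []] //=.
by rewrite !inE => /eqP gA /eqP -> _; exact: esym gA.
Qed.

Lemma model_of_satisfies (D : instance S) (a : n.-tuple (adom D)) :
  satisfies formula_of_program a ->
  exists F, [/\ facts D `<=` F, is_model P F
              & mk_atom (goal P) (map_tuple val a) \notin F].
Proof.
case=> [[D0 _]|[I hI]].
  by exists fset0; rewrite D0 fsubset_refl inE; split=> //; apply: fset0_model.
case: (pickP (predT : pred (adom D))) => [d _|noelt]; last first.
  exists fset0; rewrite inE (facts_eq0 (D := D)) ?fsubset_refl; last first.
    by move=> d; have := noelt d.
  by split=> //; apply: fset0_model.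
(* [q] reads facts off from [I]. In [p] the goal is overridden to hold of all tuples but [a], and
   schema symbols are interpreted as in [D]. *)
pose q f := [exists j, (idb_sym j == sym f) && [exists t in I j, map val t == args f]].
pose p f := if sym f == goal P then args f != map val a
            else if sym f \in symbols S then f \in facts D else q f.
have qE j (t : (idb_arity j).-tuple (adom D)) :
    q (mk_atom (idb_sym j) (map_tuple val t)) = (t \in I j).
  apply/existsP/idP=> [[j' /andP[/eqP ej /existsP[t' /andP[tI /eqP et]]]]|tI].
    have ej2 : j' = j.
      apply: val_inj; apply/eqP.
      rewrite -(nth_uniq (0,0) (ltn_ord _) (ltn_ord _) (fset_uniq _)).
      exact/eqP.
    by subst j'; suff <- : t' = t by []; apply: val_inj; apply: (inj_map val_inj).
  by exists j; rewrite eqxx; apply/existsP; exists t; rewrite tI /=.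
have goal_edb : goal P \notin edb P.
  rewrite in_fsetD negb_and orbC !inE; apply/orP; left; apply/flattenP=> -[_ /mapP[r rP ->]].
  by have /and3P[_ /negP] := allP wfP r rP.
exists (facts_of (idb P `|` edb P) (adom D) p); split.
- apply/fsubsetP=> f fD; have fS := facts_over fD.
  rewrite in_facts_of in_fsetU edbP fS orbT /p fS ifN; last first.
    by apply: contra goal_edb => /eqP <-; rewrite edbP.
  by rewrite fD andbT; apply/allP => c; apply: in_adom.
- apply: facts_of_model => // r h rP hb.
  (* The default [d] is never taken at a body variable: [h] maps those into the active domain. *)
  pose b (j : 'I_max_var.+1) := insubd d (h j).
  have hbb A x : A \in r_body r -> x \in args A -> val (b (inord x)) = h x.
    move=> Ar xA; rewrite /b inordK ?ltnS; last first.
      by apply: le_max_var rP _ xA; rewrite mem_cat Ar.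
    rewrite insubdK //; have /andP[/allP + _] := hb A Ar; apply; exact: map_f.
  have := hI b; rewrite all_map => /allP/(_ r rP) /=.
  rewrite (@clause_of_ruleE D a b I q h) // => /implyP hr.
  have [_ goal_body /implyP one] := and3P (allP wfP r rP).
  have /(_ _)/hasP[|A Ar] := hr.
    apply/allP=> A Ar; have /andP[_] := hb A Ar; rewrite /p sym_map_atom.
    rewrite ifN; last by apply: contra goal_body => /eqP <-; apply: map_f.
    have := body_in_idb_edb rP Ar; rewrite in_fsetU -edbP !in_fsetD.
    by case: (sym A \in idb P) => //= ->.
  move=> hA; apply/hasP; exists A => //; rewrite /p sym_map_atom; case: eqP => [gA|ngA].
    by rewrite ifT // in hA; rewrite /is_goal_rule -gA; apply: map_f.
  rewrite ifF; last first.
    by rewrite -edbP in_fsetD (head_in_idb rP Ar).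
  move: hA; case: ifP => // gr; case: ngA.
  move: gr (one gr) Ar; rewrite /is_goal_rule /head_syms; case: (r_head r) => [|A' []] //=.
  by rewrite !inE => /eqP -> _ /eqP ->.
- by rewrite in_facts_of /p eqxx /args /= eqxx !andbF.
Qed.

Lemma formula_of_program_equiv :
  query_equiv (program_query P S) (formula_query formula_of_program).
Proof.
move=> D a; split=> [[aD goalF]|[a' -> nsat]].
  have [a' ea] := adom_tuple aD.
  exists a' => // /model_of_satisfies[F [DF mF]].
  by move/negP; apply; have := goalF F DF mF; rewrite ea.
split=> [c /mapP[x _ ->]|F DF mF]; first exact: valP.
apply: contraT => ngoal; case: nsat; apply: satisfies_of_model DF mF ngoal.
Qed.

End OfProgram.

Lemma fgDDlog_coGMSNP : at_least_as_expressive coGMSNP fgDDlog.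
Proof.
move=> S n _ [P [wfP fgP edbP ->]].
exists (formula_query (formula_of_program S P)).
  by exists (formula_of_program S P) => //; apply: formula_of_program_GMSNP.
exact: formula_of_program_equiv.
Qed.


(** * A frontier-guarded query outside coMMSNP *)

Definition S_name := 0.
Definition R_name := 1.
Definition T_name := 2.
Definition X_name := 3.

(** Variable 1 is the parameter $y$, carried along unchanged. In the second rule the $R$-atom
    contains both variables of the head and guards it. *)
Definition propagation : program 0 := Program 0
  [:: ([:: named_atom X_name [:: 0; 1]], [:: named_atom S_name [:: 0; 1]]);
      ([:: named_atom X_name [:: 2; 1]],
       [:: named_atom X_name [:: 0; 1]; named_atom R_name [:: 0; 2; 1]]);
      ([:: named_atom 4 [::]],
       [:: named_atom X_name [:: 0; 1]; named_atom T_name [:: 0; 1]])] 4.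

Lemma in_edb_propagation R : (R \in edb propagation) =
  (R \in [:: (S_name, 2); (R_name, 3); (T_name, 2)]).
Proof.
rewrite in_fsetD !inE.
case: R => [N r]; rewrite /S_name /R_name /T_name /X_name !xpair_eqE.
by case: N => [|[|[|[|[|N]]]]] //=; case: r => [|[|[|[|r]]]].
Qed.

Lemma edb_propagation_pos R : R \in edb propagation -> 0 < arity R.
Proof. by rewrite in_edb_propagation !inE => /or3P[] /eqP ->. Qed.

Definition SRT : schema := Schema edb_propagation_pos.

Lemma instance_of_over S C p f :
  f \in facts_of (symbols S) C p -> sym f \in symbols S.
Proof. by rewrite in_facts_of => /andP[]. Qed.

Definition instance_of S C p : instance S := Instance (@instance_of_over S C p).

(** * The two families of instances *)

Definition initial (N : nat) : {fset nat} := [fset c in iota 0 N].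

Lemma in_initial N c : (c \in initial N) = (c < N).
Proof. by rewrite inE mem_iota. Qed.

(** The first two arguments agree for $S$ and $R$ and differ for $T$; the third argument of $R$ is
    arbitrary. Applied to the predicate $X$, this is equality. *)
Definition equality_pred (f : atom nat) : bool :=
  (nth 0 (args f) 0 == nth 0 (args f) 1) == ((sym f).1 != T_name).

Definition equality_instance (N : nat) : instance SRT :=
  instance_of SRT (initial N) equality_pred.

(** The path is $1, \dots, m+1$, with 0 as the parameter $y$. The condition $0 < c$ keeps 0 off the
    path, and the choice of constants in [chain_instance] bounds it above. *)
Definition chain_pred (m : nat) (f : atom nat) : bool :=
  match (sym f).1, args f with
  | 0, s => s == [:: 1; 0]
  | 1, c :: s => (0 < c) && (s == [:: c.+1; 0])
  | _, s => s == [:: m.+1; 0]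
  end.

Definition chain_instance (m : nat) : instance SRT :=
  instance_of SRT (initial m.+2) (chain_pred m).

(** Interpreting $X$ as equality gives a model without goal: the links are loops, and no $T$-fact
    has equal arguments. *)
Lemma propagation_equality N (a : 0.-tuple nat) :
  ~ program_answer propagation (equality_instance N) a.
Proof.
pose p f := (sym f != goal propagation) && equality_pred f.
case=> _ /(_ (facts_of (idb propagation `|` edb propagation) (initial N) p)).
have -> : (mk_atom (goal propagation) a \in
    facts_of (idb propagation `|` edb propagation) (initial N) p) = false.
  by rewrite in_facts_of /p eqxx /= !andbF.
move=> h; apply/notF/h.
  apply/fsubsetP=> f; rewrite !in_facts_of in_fsetU => /and3P[fS -> pf].
  rewrite fS orbT /p pf andbT /=.
  by move: fS; rewrite in_edb_propagation !inE => /or3P[] /eqP ->.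
apply: facts_of_model => // r v; rewrite !inE => /or3P[] /eqP -> /= b.
- have := b _ (mem_head _ _); rewrite !map_named_atom /p /equality_pred /=.
  by case/andP=> _ ->.
- have b1 := b _ (mem_head _ _); have := b _ (mem_last _ [:: _]).
  move: b1; rewrite !map_named_atom /p /equality_pred /=.
  by case/andP=> _ /eqP/eqP <-; rewrite orbF (eq_sym (v 2)) => /andP[].
- have b1 := b _ (mem_head _ _); have := b _ (mem_last _ [:: _]).
  move: b1; rewrite !map_named_atom /p /equality_pred /=.
  by case/andP=> _ /eqP ->; rewrite andbF.
Qed.

(** In every model $X(j, 0)$ follows for each point $j$ by induction along the path, until the
    $T$-fact yields the goal. *)
Lemma propagation_chain m (a : 0.-tuple nat) :
  program_answer propagation (chain_instance m) a.
Proof.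
split=> [|F sF [_ mF]]; first by rewrite tuple0.
have inF N s : (N, size s) \in edb propagation -> all (mem (initial m.+2)) s ->
    chain_pred m (named_atom N s) -> named_atom N s \in F.
  move=> NS sm ch; apply: (fsubsetP sF).
  by rewrite in_facts_of NS sm.
have X j : j < m.+1 -> named_atom X_name [:: j.+1; 0] \in F.
  elim: j => [_|j IH]; last rewrite ltnS => lt_jm.
    (* This substitution exchanges 0 and 1, which turns the body into the fact $S(1, 0)$. *)
    have := mF _ (mem_head _ _) (fun i => 1 - i); rewrite /= !map_named_atom /=.
    rewrite !andbT orbF; apply; apply: inF => //.
      by rewrite in_edb_propagation.
    by rewrite /= !in_initial.
  pose v i := nth 0 [:: j.+1; 0; j.+2] i.
  have := mF (nth ([::], [::]) (rules propagation) 1) (mem_nth _ _) v.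
  rewrite /= !map_named_atom /= !andbT orbF; apply=> //; rewrite (IH (ltnW lt_jm)) /=.
  apply: inF; first by rewrite in_edb_propagation.
    by rewrite /= !in_initial !ltnS (ltnW lt_jm) lt_jm.
  by rewrite /chain_pred /= eqxx.
pose v i := nth 0 [:: m.+1; 0] i.
have := mF (nth ([::], [::]) (rules propagation) 2) (mem_nth _ _) v.
rewrite /= !map_named_atom /= !andbT orbF.
have -> : mk_atom (goal propagation) a = named_atom 4 [::].
  by apply: atom_eq => //; rewrite [a]tuple0.
apply=> //; rewrite X //=; apply: inF; first by rewrite in_edb_propagation.
  by rewrite /= !in_initial !ltnS leqnn.
by rewrite /chain_pred /= eqxx.
Qed.

(* Deleting one link i of the chain leaves two halves, which can be folded onto
   the loops at (x, x) and (y, x). *)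
Lemma fold_broken_chain m N x y i f :
  x < N -> y < N -> y != x -> 0 < i <= m.+1 -> i \notin args f ->
  f \in facts (chain_instance m) ->
  map_atom (fun c => if i < c then y else x) f \in facts (equality_instance N).
Proof.
move=> xN yN yx /andP[i0 im] fi; rewrite !in_facts_of sym_map_atom args_map_atom.
case/and3P=> fS _ ch; rewrite fS /=; apply/andP; split.
  by apply/allP=> _ /mapP[c _ ->] /=; case: ifP; rewrite in_initial.
move: fS ch fi; rewrite in_edb_propagation !inE /chain_pred /equality_pred.
rewrite sym_map_atom args_map_atom => /or3P[] /eqP -> /=.
- by move=> /eqP -> /=; rewrite !inE => /norP[i1 _]; rewrite (ltnNge i 1) i0 /= eqxx.
- case: (args f) => // c s /andP[c0 /eqP ->]; rewrite !inE => /norP[ic /norP[ic1 _]] /=.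
  by rewrite ltnS (leq_eqVlt i) (negPf ic) /= eqxx.
- move=> /eqP -> /=; rewrite !inE => /norP[im1 _].
  by rewrite ltn_neqAle im1 im /= (negPf yx).
Qed.

(** * Colourings and inexpressibility in MMSNP *)

Lemma pigeonhole_colour (T : finType) k (colour : T -> 'I_k -> bool) :
  2 ^ k < #|T| -> exists x y, x != y /\ colour x =1 colour y.
Proof.
move=> ltk; pose col x := [ffun j => colour x j].
have [/injectiveP/leq_card|/injectivePn[x [y xy cxy]]] := boolP (injectiveb col).
  by rewrite card_ffun card_bool card_ord leqNgt ltk.
by exists x, y; split=> // j; have /ffunP/(_ j) := cxy; rewrite !ffunE.
Qed.

(** The colouring of the chain is fixed before the variables get values, whereas the missed point
    [i], and with it the folding map, depends on them. As [x] and [y] have the same colour, every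
    such map preserves colours. *)
Lemma MMSNP_chain N (Phi : formula SRT 0) (a : 0.-tuple (adom (equality_instance N)))
    (a' : 0.-tuple (adom (chain_instance (num_fo Phi)))) :
  is_MMSNP Phi -> 2 ^ num_so Phi < N -> satisfies Phi a -> satisfies Phi a'.
Proof.
move=> mPhi ltN; have adomN (c : 'I_N) : val c \in adom (equality_instance N).
  apply: (@in_adom _ _ (named_atom S_name [:: val c; val c])); last exact: mem_head.
  rewrite in_facts_of in_edb_propagation /= in_initial ltn_ord /=.
  by rewrite /equality_pred /= eqxx.
case=> [[D0 _]|[I hI]].
  by case: (adom0 D0 [` adomN (Ordinal ltN)]).
pose el c : adom (equality_instance N) := [` adomN c].
(* The constant tuple stands for the single element [el c]: the arity equals 1 only by hypothesis,
   not by computation. *)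
pose colour c j := nseq_tuple (so_arity j) (el c) \in I j.
have [|x [y [xy cxy]]] := @pigeonhole_colour _ _ colour; first by rewrite card_ord.
right; exists (fun j => [set _ | colour x j]) => b'.
set m := num_fo Phi in a' b' *.
(* The $m$ variables cannot take all of the $m+1$ values on the path. *)
have /allPn[i] : ~~ all (mem [seq val (b' v) | v : 'I_m]) (iota 1 m.+1).
  apply/negP=> /allP /(uniq_leq_size (iota_uniq _ _)).
  by rewrite size_iota size_map -cardE card_ord ltnn.
rewrite mem_iota add1n => i_range i_missing.
(* The parameter 0 lies below [i], hence goes to [x] as the folding requires. *)
pose g (u : adom (chain_instance m)) := if i < val u then el y else el x.
have colour_g j (t : (so_arity j).-tuple (adom (chain_instance m))) :
    (map_tuple g t \in I j) = colour x j.
  have : size t = 1 by rewrite size_tuple mPhi.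
  case E: (tval t) => [|u []] // _.
  have -> : map_tuple g t = nseq_tuple (so_arity j) (g u).
    by apply: val_inj; rewrite /= E mPhi.
  by rewrite /g; case: ifP => // _; rewrite cxy.
have nuE z : assignment a (g \o b') z = g (assignment a' b' z).
  by case: z => // -[].
have soE A : so_holds I (assignment a (g \o b')) A =
    so_holds (fun j => [set _ | colour x j]) (assignment a' b') A.
  rewrite /so_holds inE -(colour_g _ (map_tuple (assignment a' b') (so_args A))).
  set t := map_tuple g _; suff -> : map_tuple (assignment a (g \o b')) (so_args A) = t by [].
  by apply: val_inj; rewrite /= -map_comp; apply: eq_map.
apply: sub_all _ (hI (g \o b')) => c; rewrite /clause_holds => /implyP hc.
apply/implyP=> hb; rewrite -(eq_has soE); apply: hc; apply: sub_all _ hb.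
case=> [A|R t|u v] /=; first by rewrite soE.
  set f := mk_atom _ _ => fD.
  suff -> : mk_atom (val R) (map_tuple (fun z => val (assignment a (g \o b') z)) t) =
      map_atom (fun c => if i < c then val y else val x) f.
    (* The arguments of [f] are values of variables, so [i] is not among them. *)
    apply: (@fold_broken_chain m); rewrite ?ltn_ord 1?eq_sym //.
    apply: contra i_missing => /mapP[[[]//|v] _ ->].
    by apply/mapP; exists v; rewrite ?mem_enum.
  apply: atom_eq => //; rewrite args_map_atom -map_comp; apply: eq_map => z.
  by rewrite /= nuE /g; case: ifP.
by rewrite !nuE => /eqP ->.
Qed.

Lemma coMMSNP_not_fgDDlog : ~ at_least_as_expressive coMMSNP fgDDlog.
Proof.
move=> /(_ SRT 0 (program_query propagation SRT))[|_ [Phi mPhi ->] eqv].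
  by exists propagation; split.
have [a' _ nsat] := (eqv (chain_instance (num_fo Phi)) [tuple]).1 (propagation_chain _ _).
(* One element more than there are colours. *)
pose N := (2 ^ num_so Phi).+1.
apply: (@propagation_equality N [tuple]); apply/(eqv _ _).2.
exists [tuple]; first exact: val_inj.
by move=> sat; apply: nsat; apply: (MMSNP_chain _ mPhi (ltnSn _) sat).
Qed.

Theorem theorem11 :
  same_expressive_power coGMSNP fgDDlog /\
  strictly_more_expressive coGMSNP coMMSNP.
Proof.
split; split; [exact: fgDDlog_coGMSNP | exact: coGMSNP_fgDDlog | exact: coGMSNP_coMMSNP |].
(* If coMMSNP covered coGMSNP, it would also cover frontier-guarded DDlog, by composing with the
   translation of programs into formulas. *)
move=> coMMSNP_coGMSNP; apply: coMMSNP_not_fgDDlog => S n q.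
move=> /fgDDlog_coGMSNP[q1 /coMMSNP_coGMSNP[q2 q2M e2] e1].
by exists q2 => // D a; apply: iff_trans (e1 D a) (e2 D a).
Qed.
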